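(* Let $F^\bullet$ be a bounded sequence of based finite-rank free $R_n$-modules with homogeneous basis indexed by $I$, let $(x_i)_{i\in I}\in(\mathbb{R}^n)^I$ be a choice of points, let $X(F^\bullet)$ be the associated semi-simplicial complex over $T^n$ and $T(F^\bullet)\subset T^n$ its image. Suppose the $x_i$ are generic and the interior of $T(F^\bullet)$ is empty. Then for $i_0,\dots,i_k\in I$ and $\overline{m}_1,\dots,\overline{m}_k\in\mathbb{Z}^n$ the simplex $\sigma_k=[x_{i_0},x_{i_1}+\overline{m}_1,\dots,x_{i_k}+\overline{m}_k]\bmod\mathbb{Z}^n$ belongs to $X(F^\bullet)_k$ if and only if $\deg(i_0)<\cdots<\deg(i_k)$ and the image of $\sigma_k$ is contained in $T(F^\bullet)$. In particular, the discrete information in $F^\bullet$ can be recovered up to equivalence from $T(F^\bullet)$, $T(F^\bullet)_0$, and the function $\deg:T(F^\bullet)_0\to\mathbb{Z}$.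
   Context: $R_n:=\mathbb{C}[z_1^{\pm1},\dots,z_n^{\pm1}]$, $T^n=\mathbb{R}^n/\mathbb{Z}^n$, $\pi:\mathbb{R}^n\to T^n$ is the projection, and $z^m=z_1^{m_1}\cdots z_n^{m_n}$ for $m\in\mathbb{Z}^n$. Sequences. $F^\bullet=\cdots\to F^k\xrightarrow{d^k}F^{k+1}\to\cdots$ is a bounded sequence of finite-rank free $R_n$-modules and homomorphisms (it is not required that $d^2=0$). It is based: for each $k$ there is a fixed finite set $I_k$ and an isomorphism $F^k\cong R_n^{\oplus I_k}$. $I:=\bigsqcup_k I_k$ and $\deg:I\to\mathbb{Z}$ is $\deg(i)=k$ for $i\in I_k$. It is assumed $F^0\not\cong0$ and $F^k\cong0$ for $k>0$. For $i\in I_{k+1}$, $j\in I_k$, $d^k_{ij}\in R_n$ is the entry in row $i$, column $j$ of the matrix of $d^k$. Exponent sets $E_{ij}\subset\mathbb{Z}^n$ for $i,j\in I$: (a) if $\deg(i)\le\deg(j)$, $E_{ij}=\emptyset$; (b) if $\deg(i)=\deg(j)+1$, $E_{ij}$ is the set of exponents of $d^{\deg(j)}_{ij}$, i.e. $d^{\deg(j)}_{ij}=\sum_{m\in E_{ij}}c_{ijm}z^m$ with all $c_{ijm}\ne0$; (c) if $\deg(i)=\deg(j)+k$ with $k>1$, then $m\in E_{ij}$ iff $m=\sum_{\ell=1}^k m_\ell$ for some $i_1,\dots,i_{k-1}\in I$ with $\deg(i_\ell)=\deg(j)+\ell$ and some $(m_1,\dots,m_k)\in E_{i_1j}\times E_{i_2i_1}\times\cdots\times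 E_{i\,i_{k-1}}$. Simplices. For $y_0,\dots,y_k\in\mathbb{R}^n$, $[y_0,\dots,y_k]\bmod\mathbb{Z}^n$ is the map $\Delta^k\to T^n$ obtained by composing the linear map sending the vertices of $\Delta^k$ in order to $y_0,\dots,y_k$ with $\pi$. $X(F^\bullet)=\{X(F^\bullet)_k\}_{k\in\mathbb{N}}$ is defined, given points $x_i\in\mathbb{R}^n$ $(i\in I)$, by $$X(F^\bullet)_k:=\bigcup_{i_0,\dots,i_k\in I}\Big\{\big[x_{i_0},\,x_{i_1}+m_1,\,\dots,\,x_{i_k}+\textstyle\sum_{\ell=1}^k m_\ell\big]\bmod\mathbb{Z}^n \;:\;(m_1,\dots,m_k)\in E_{i_1i_0}\times\cdots\times E_{i_ki_{k-1}}\Big\},$$ with $X(F^\bullet)_0=\{[x_i]\bmod\mathbb{Z}^n\}_{i\in I}$. $T(F^\bullet)\subset T^n$ is the union of the images of all simplices in $X(F^\bullet)$, and $T(F^\bullet)_0\subset T^n$ is the image of $X(F^\bullet)_0$. When the $x_i$ are distinct modulo $\mathbb{Z}^n$, $T(F^\bullet)_0\cong I$, and $\deg:T(F^\bullet)_0\to\mathbb{Z}$ corresponds to $\deg:I\to\mathbb{Z}$. Generic: a conclusion holds for generic $x_i$ if the set of $(x_i)_{i\in I}\in(\mathbb{R}^n)^I$ for which (the other hypotheses hold and) it fails has measure zero. Discrete information. The discrete information in $F^\bullet$ consists of the index set $I$, the function $\deg:I\to\mathbb{Z}$, and the function $E:I\times I\to P(\mathbb{Z}^n)$, $(i,j)\mapsto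 E_{ij}$, where $P(\mathbb{Z}^n)$ is the power set. Two collections of such information are equivalent if they differ by a finite sequence of the following operations: transferring all the data across a bijection $I\cong I'$ of index sets; and, for some $i\in I$ and $m\in\mathbb{Z}^n$, adding $m$ to each element of $E_{ij}$ and $-m$ to each element of $E_{ji}$ for all $j$. ''Can be recovered up to equivalence from'' given data means: the equivalence class of the discrete information is determined by that data. *)

(* Defs.v *)
From HB Require Import structures.
From Stdlib Require Import Relation_Operators.
From mathcomp Require Import all_boot all_order all_algebra.
From mathcomp Require Import finmap generic_quotient complex.
From mathcomp Require Import all_classical all_reals all_analysis.
Set Implicit Arguments.
Unset Strict Implicit.
Unset Printing Implicit Defensive.
Import Order.TTheory GRing.Theory Num.Theory.
Import numFieldNormedType.Exports.
Local Open Scope classical_set_scope.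
Local Open Scope ring_scope.

(* C[z_1^{+-1}, ..., z_n^{+-1}], as the group algebra C[Z^n]: a Laurent
   polynomial is its finitely supported coefficient function. *)
Definition laurent (C : comNzRingType) (n : nat) : Type :=
  {fsfun 'rV[int]_n -> C with 0}.

Section LaurentRing.
Variables (C : comNzRingType) (n : nat).
Implicit Types (f g h : laurent C n) (m a b : 'rV[int]_n).
Implicit Types (d : {fset 'rV[int]_n}).

Definition lcoef f m : C := (f : {fsfun 'rV[int]_n -> C with 0}) m.
Definition lsupp f : {fset 'rV[int]_n} :=
  finsupp (f : {fsfun 'rV[int]_n -> C with 0}).

Definition lzero : laurent C n := [fsfun].
Definition lopp f : laurent C n := [fsfun m in lsupp f => - lcoef f m].
Definition ladd f g : laurent C n :=
  [fsfun m in (lsupp f `|` lsupp g)%fset => lcoef f m + lcoef g m].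
Definition lmonomial m : laurent C n := [fsfun m' in [fset m]%fset => 1].
Definition lmul f g : laurent C n :=
  [fsfun m in [fset (a + b)%R | a in lsupp f, b in lsupp g]%fset =>
     \sum_(a <- lsupp f) lcoef f a * lcoef g (m - a)].

Lemma laurentP f g : (forall m, lcoef f m = lcoef g m) -> f = g.
Proof. by move=> fg; apply/fsfunP. Qed.

Lemma lcoef_neq0 f m : (lcoef f m != 0) = (m \in lsupp f).
Proof. by rewrite mem_finsupp. Qed.

Lemma lcoef_out f m : m \notin lsupp f -> lcoef f m = 0.
Proof. by rewrite -lcoef_neq0 negbK => /eqP. Qed.

Lemma lcoef0 m : lcoef lzero m = 0.
Proof. by rewrite /lcoef fsfun0E. Qed.

Lemma lcoefN f m : lcoef (lopp f) m = - lcoef f m.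
Proof.
by rewrite {1}/lcoef fsfunE; case: ifPn => // /lcoef_out ->; rewrite oppr0.
Qed.

Lemma lcoefD f g m : lcoef (ladd f g) m = lcoef f m + lcoef g m.
Proof.
rewrite {1}/lcoef fsfunE in_fsetU; case: ifPn => //.
by rewrite negb_or => /andP[/lcoef_out -> /lcoef_out ->]; rewrite addr0.
Qed.

Lemma lcoefX m m' : lcoef (lmonomial m) m' = (m' == m)%:R.
Proof. by rewrite {1}/lcoef fsfunE in_fset1; case: eqP. Qed.

Lemma lcoefM f g m :
  lcoef (lmul f g) m = \sum_(a <- lsupp f) lcoef f a * lcoef g (m - a).
Proof.
rewrite {1}/lcoef fsfunE; case: ifPn => // mfg.
rewrite big_seq big1 // => a fa.
have [gma|/lcoef_out ->] := boolP (m - a \in lsupp g); last by rewrite mulr0.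
case/negP: mfg; apply/imfset2P; exists a => //; exists (m - a) => //.
by rewrite addrC subrK.
Qed.

Lemma lcoefMl d f g m : (lsupp f `<=` d)%fset ->
  lcoef (lmul f g) m = \sum_(a <- d) lcoef f a * lcoef g (m - a).
Proof.
move=> fd; rewrite lcoefM; apply: big_fset_incl => // a _ /lcoef_out ->.
by rewrite mul0r.
Qed.

Lemma sum_delta d (F : 'rV[int]_n -> C) c :
  (c \notin d -> F c = 0) -> \sum_(b <- d) F b *+ (b == c) = F c.
Proof.
move=> Fc; have [cd|cd] := boolP (c \in d).
  rewrite (big_fsetD1 c) //= eqxx big_seq big1 ?addr0 // => b.
  by rewrite in_fsetD1 => /andP[/negPf ->].
rewrite Fc // big_seq big1 // => b bd.
by case: eqP => // e; rewrite e (negPf cd) in bd.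
Qed.

Lemma lcoefM2 f g m : lcoef (lmul f g) m =
  \sum_(a <- lsupp f) \sum_(b <- lsupp g) lcoef f a * lcoef g b *+ (a + b == m).
Proof.
rewrite lcoefM; apply: eq_bigr => a _.
rewrite -[LHS](@sum_delta (lsupp g) (fun b => lcoef f a * lcoef g b)).
  by apply: eq_bigr => b _; rewrite eq_sym subr_eq addrC eq_sym.
by move=> /lcoef_out ->; rewrite mulr0.
Qed.

Lemma laddA : associative ladd.
Proof. by move=> f g h; apply: laurentP => m; rewrite !lcoefD addrA. Qed.

Lemma laddC : commutative ladd.
Proof. by move=> f g; apply: laurentP => m; rewrite !lcoefD addrC. Qed.

Lemma ladd0 : left_id lzero ladd.
Proof. by move=> f; apply: laurentP => m; rewrite lcoefD lcoef0 add0r. Qed.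

Lemma laddN : left_inverse lzero lopp ladd.
Proof.
by move=> f; apply: laurentP => m; rewrite lcoefD lcoefN lcoef0 addNr.
Qed.

HB.instance Definition _ := Choice.on (laurent C n).
HB.instance Definition _ :=
  GRing.isZmodule.Build (laurent C n) laddA laddC ladd0 laddN.

Lemma lmulC : commutative lmul.
Proof.
move=> f g; apply: laurentP => m; rewrite !lcoefM2 exchange_big /=.
by apply: eq_bigr => b _; apply: eq_bigr => a _; rewrite mulrC addrC.
Qed.

Lemma lmulA : associative lmul.
Proof.
move=> f g h; apply: laurentP => m.
pose d := [fset (a + b)%R | a in lsupp f, b in lsupp g]%fset.
rewrite lcoefM [RHS](@lcoefMl d); last first.
  apply/fsubsetP => c; rewrite -lcoef_neq0.
  by rewrite {1}/lcoef fsfunE; case: ifP => //; rewrite eqxx.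
under [RHS]eq_bigr => c _ do rewrite lcoefM mulr_suml.
rewrite exchange_big big_seq [RHS]big_seq /=; apply: eq_bigr => a fa.
rewrite lcoefM mulr_sumr.
transitivity (\sum_(b <- lsupp g) \sum_(c <- d)
    (lcoef f a * lcoef g b * lcoef h (m - c)) *+ (c == a + b)).
  rewrite big_seq [RHS]big_seq; apply: eq_bigr => b gb.
  rewrite (sum_delta (F := fun c => lcoef f a * lcoef g b * lcoef h (m - c))).
    by rewrite mulrA opprD addrA.
  by case/negP; apply/imfset2P; exists a => //; exists b.
rewrite exchange_big; apply: eq_bigr => c _ /=.
rewrite -[RHS](sum_delta (d := lsupp g)
  (F := fun b => lcoef f a * lcoef g b * lcoef h (m - c))).
  by apply: eq_bigr => b _; rewrite [a + b]addrC -subr_eq eq_sym.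
by move=> /lcoef_out ->; rewrite mulr0 mul0r.
Qed.

Lemma lmul1 : left_id (lmonomial 0) lmul.
Proof.
move=> f; apply: laurentP => m; rewrite (@lcoefMl [fset 0]%fset).
  by rewrite big_seq_fset1 lcoefX eqxx mul1r subr0.
apply/fsubsetP => c; rewrite -lcoef_neq0 lcoefX in_fset1.
by case: (c == 0); rewrite ?eqxx.
Qed.

Lemma lmulDl : left_distributive lmul ladd.
Proof.
move=> f g h; apply: laurentP => m; rewrite lcoefD.
have df := fsubsetUl (lsupp f) (lsupp g).
have dg := fsubsetUr (lsupp f) (lsupp g).
rewrite (lcoefMl _ _ df) (lcoefMl _ _ dg) (@lcoefMl (lsupp f `|` lsupp g)%fset).
  by rewrite -big_split; apply: eq_bigr => a _ /=; rewrite lcoefD mulrDl.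
apply/fsubsetP => c; rewrite -lcoef_neq0 lcoefD in_fsetU -!lcoef_neq0.
by apply: contraNT; rewrite negb_or !negbK => /andP[/eqP-> /eqP->]; rewrite addr0.
Qed.

Lemma loner_neq0 : lmonomial 0 != lzero.
Proof.
apply/eqP => /(congr1 (lcoef^~ 0)); rewrite lcoefX lcoef0 eqxx.
by move/eqP; rewrite oner_eq0.
Qed.

HB.instance Definition _ := GRing.Zmodule_isComNzRing.Build (laurent C n)
  lmulA lmulC lmul1 lmulDl loner_neq0.

End LaurentRing.

(* A based sequence is given by the total index set I with its degree map, so
   that I_k = {i | deg i = k} and F^k = R_n^{I_k}; finiteness of I amounts to
   the boundedness of the sequence together with the finite ranks. *)
Definition deg_basis (I : finType) (deg : I -> int) (k : int) : finType :=
  {i : I | deg i == k}.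

Definition free_module (C : comNzRingType) (n : nat) (I : finType)
    (deg : I -> int) (k : int) : lmodType (laurent C n) :=
  {ffun deg_basis deg k -> (laurent C n)^o}.

Record based_seq (R : realType) (n : nat) := BasedSeq {
  seq_index : finType;
  seq_deg : seq_index -> int;
  seq_diff : forall k : int,
    {linear free_module R[i] n seq_deg k -> free_module R[i] n seq_deg (k + 1)};
  seq_deg_le0 : forall i, seq_deg i <= 0;
  seq_deg0 : exists i, seq_deg i = 0 }.

Section Exponents.
Variables (R : realType) (n : nat) (F : based_seq R n).
Local Notation I := (seq_index F).
Local Notation deg := (@seq_deg R n F).

Definition basis_vector (k : int) (j : deg_basis deg k) :
    free_module R[i] n deg k :=
  [ffun j' => (j' == j)%:R].

Definition diff_entry (k : int) (i : deg_basis deg (k + 1))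
    (j : deg_basis deg k) : laurent R[i] n :=
  seq_diff F k (basis_vector j) i.

Definition diff_exponents (i j : I) : set 'rV[int]_n :=
  [set m | exists ij : deg i == deg j + 1,
     lcoef (@diff_entry (deg j) (exist _ i ij) (exist _ j (eqxx (deg j)))) m
       != 0].

Definition prev_index k (l : 'I_k) : 'I_k.+1 := widen_ord (leqnSn k) l.
Definition next_index k (l : 'I_k) : 'I_k.+1 := lift ord0 l.

Definition composite_exponents (i j : I) : set 'rV[int]_n :=
  [set m | exists k : nat, [/\ (1 < k)%N, deg i = deg j + k%:Z &
     exists (c : 'I_k.+1 -> I) (p : 'I_k -> 'rV[int]_n),
       [/\ c ord0 = j, c ord_max = i,
           forall l, deg (c l) = deg j + (l : nat)%:Z,
           forall l, diff_exponents (c (next_index l)) (c (prev_index l)) (p l)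
         & m = \sum_l p l]]].

Definition exponents (i j : I) : set 'rV[int]_n :=
  diff_exponents i j `|` composite_exponents i j.

End Exponents.

Section Torus.
Variables (R : realType) (n : nat).

Definition of_lattice (m : 'rV[int]_n) : 'rV[R]_n := map_mx intr m.

Definition lattice_equiv (x y : 'rV[R]_n) : bool :=
  `[< exists m, x = y + of_lattice m >].

Lemma lattice_equiv_refl : reflexive lattice_equiv.
Proof. by move=> x; apply/asboolP; exists 0; rewrite /of_lattice raddf0 addr0. Qed.

Lemma lattice_equiv_sym : symmetric lattice_equiv.
Proof.
by move=> x y; apply/asboolP/asboolP => -[m ->]; exists (- m);
  rewrite /of_lattice raddfN /= addrK.
Qed.

Lemma lattice_equiv_trans : transitive lattice_equiv.
Proof.
move=> y x z /asboolP[m ->] /asboolP[p ->]; apply/asboolP; exists (p + m).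
by rewrite /of_lattice raddfD addrA.
Qed.

Canonical lattice_equiv_rel :=
  EquivRel lattice_equiv lattice_equiv_refl lattice_equiv_sym
    lattice_equiv_trans.

Definition torus := quotient_topology {eq_quot lattice_equiv_rel}%qT.

Definition torus_proj (x : 'rV[R]_n) : torus := (\pi_torus x)%qT.

Definition std_simplex (k : nat) : set 'rV[R]_k.+1 :=
  [set t | (forall j, 0 <= t 0 j) /\ \sum_j t 0 j = 1].
Arguments std_simplex : clear implicits.

(* [y_0, ..., y_k] mod Z^n *)
Definition simplex (k : nat) (y : 'I_k.+1 -> 'rV[R]_n) :
    std_simplex k -> torus :=
  fun t => torus_proj (\sum_j val t 0 j *: y j).

End Torus.
Arguments std_simplex : clear implicits.

Section Complex.
Variables (R : realType) (n : nat) (F : based_seq R n).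
Variable x : seq_index F -> 'rV[R]_n.

Definition complex_of (k : nat) : set (std_simplex R k -> torus R n) :=
  [set s | exists (i : 'I_k.+1 -> seq_index F) (m : 'I_k -> 'rV[int]_n),
     (forall l, exponents (i (next_index l)) (i (prev_index l)) (m l)) /\
     s = simplex (fun j =>
           x (i j) + of_lattice R (\sum_(l < k | (l < j)%N) m l))].
Arguments complex_of : clear implicits.

Definition complex_image : set (torus R n) :=
  \bigcup_k \bigcup_(s in complex_of k) range s.

Definition complex_image0 : set (torus R n) :=
  \bigcup_(s in complex_of 0) range s.

Definition is_vertex_deg (delta : complex_image0 -> int) : Prop :=
  forall (p : complex_image0) (i : seq_index F),
    val p = torus_proj (x i) -> delta p = seq_deg i.

End Complex.
Arguments complex_of {R n F} x k.

(* Lebesgue-null subsets of (R^n)^I, through countable covers by boxes of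
   arbitrarily small total volume; the index set D of the cover may be empty,
   which matters in dimension 0, where every box has volume 1. *)
Definition null_set (R : realType) (n : nat) (I : finType)
    (A : set (I -> 'rV[R]_n)) : Prop :=
  forall e : R, 0 < e ->
  exists (D : set nat) (a b : nat -> I -> 'rV[R]_n),
    [/\ forall k i j, a k i 0 j <= b k i 0 j,
        A `<=` \bigcup_(k in D)
          [set x | forall i j, a k i 0 j <= x i 0 j <= b k i 0 j]
      & (\esum_(k in D) (\prod_i \prod_j (b k i 0 j - a k i 0 j))%:E
           <= e%:E)%E].

Definition generically (R : realType) (n : nat) (I : finType)
    (P : (I -> 'rV[R]_n) -> Prop) : Prop :=
  null_set [set x | ~ P x].

Record discrete_info (n : nat) := DiscreteInfo {
  info_index : finType;
  info_deg : info_index -> int;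
  info_exp : info_index -> info_index -> set 'rV[int]_n }.

Inductive info_step (n : nat) : discrete_info n -> discrete_info n -> Prop :=
| InfoTransfer (I I' : finType) (f : I -> I') (deg : I -> int) (deg' : I' -> int)
    (E : I -> I -> set 'rV[int]_n) (E' : I' -> I' -> set 'rV[int]_n) :
    bijective f ->
    (forall i, deg' (f i) = deg i) ->
    (forall i j, E' (f i) (f j) = E i j) ->
    info_step (DiscreteInfo deg E) (DiscreteInfo deg' E')
| InfoShift (I : finType) (deg : I -> int) (E : I -> I -> set 'rV[int]_n)
    (i : I) (m : 'rV[int]_n) :
    info_step (DiscreteInfo deg E)
      (DiscreteInfo deg (fun a b =>
         [set p + (if a == i then m else 0) - (if b == i then m else 0)
         | p in E a b])).

(* Both kinds of steps are reversible, so this is an equivalence relation. *)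
Definition info_equiv (n : nat) : discrete_info n -> discrete_info n -> Prop :=
  clos_refl_trans _ (@info_step n).

Definition info_of (R : realType) (n : nat) (F : based_seq R n) :
    discrete_info n :=
  DiscreteInfo (@seq_deg R n F) (@exponents R n F).

(* Main.v *)
(* If T(F) has empty interior and the x_i are generic, all simplices of X(F) have
   dimension less than n, since n + 1 generic points span an n-simplex. By
   transitivity of the exponent sets, it is enough to recognise the edges. An
   edge [x_i, x_j + m] contained in T(F) has uncountably many points and is
   covered by the countably many lifts of the simplices of X(F), so one lift
   contains two points of the edge, and its affine span, of dimension less than n,
   contains the whole line. Generically x_i and x_j + m can lie in this span only
   as vertices, so the edge is a face of a simplex of X(F).

   For the second claim, T, T_0 and deg determine the edges contained in T up to
   the choice of lifts of the points of T_0, and changing the lifts shifts the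
   exponent sets. *)
From Pilot Require Import Defs.
From Stdlib Require Import Relation_Operators.
From mathcomp Require Import all_boot all_order all_algebra.
From mathcomp Require Import finmap complex ring lra.
From mathcomp Require Import all_classical all_reals all_analysis.
Set Implicit Arguments.
Unset Strict Implicit.
Unset Printing Implicit Defensive.
Import Order.TTheory GRing.Theory Num.Theory.
Import numFieldNormedType.Exports.
Local Open Scope classical_set_scope.
Local Open Scope ring_scope.
(* MathComp-Analysis has another [null_set]. *)
Local Notation null_set := Pilot.Defs.null_set.

(** * Null sets *)

Section NullSets.
Variables (R : realType) (n : nat) (I : finType).
Implicit Types (a b : I -> 'rV[R]_n) (A B : set (I -> 'rV[R]_n)).

Definition box a b : set (I -> 'rV[R]_n) :=
  [set x | forall i j, a i 0 j <= x i 0 j <= b i 0 j].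

Definition box_volume a b : R := \prod_i \prod_j (b i 0 j - a i 0 j).

Lemma box_volume_ge0 a b :
  (forall i j, a i 0 j <= b i 0 j) -> 0 <= box_volume a b.
Proof.
by move=> ab; apply: prodr_ge0 => i _; apply: prodr_ge0 => j _; rewrite subr_ge0.
Qed.

Lemma null_set0 : null_set (set0 : set (I -> 'rV[R]_n)).
Proof.
move=> e e0; exists set0, (fun=> fun=> 0), (fun=> fun=> 0).
by split=> //; rewrite esum_set0 lee_fin ltW.
Qed.

Lemma null_set_sub A B : A `<=` B -> null_set B -> null_set A.
Proof.
move=> AB nB e /nB[D [a [b [ab Bab le_e]]]].
by exists D, a, b; split => // x /AB /Bab.
Qed.

Lemma generically_sub (P Q : (I -> 'rV[R]_n) -> Prop) :
  (forall x, P x -> Q x) -> generically P -> generically Q.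
Proof. by move=> PQ; apply: null_set_sub => x; apply/contra_not/PQ. Qed.

(** Codes move the cover to one indexed by [nat]. Numbers that code nothing get the box at the
    origin and stay outside the new index set. *)
Lemma null_set_countable_cover A :
  (forall e : R, 0 < e ->
   exists (T : countType) (D : set T) (a b : T -> I -> 'rV[R]_n),
    [/\ forall t i j, a t i 0 j <= b t i 0 j,
        A `<=` \bigcup_(t in D) box (a t) (b t)
      & (\esum_(t in D) (box_volume (a t) (b t))%:E <= e%:E)%E]) ->
  null_set A.
Proof.
move=> cov e /cov[T [D [a [b [ab Aab le_e]]]]].
pose ext (c : T -> I -> 'rV[R]_n) k := oapp c (fun=> 0) (choice.unpickle k).
have extE c t : ext c (choice.pickle t) = c t by rewrite /ext choice.pickleK.
exists (choice.pickle @` D), (ext a), (ext b); split.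
- by move=> k i j; rewrite /ext; case: choice.unpickle => [t|] /=.
- move=> x /Aab[t Dt xt]; exists (choice.pickle t); first by exists t.
  by rewrite /= !extE.
- rewrite esum_image; last by move=> s t _ _; apply: (pcan_inj choice.pickleK).
  by under eq_esum => t _ do rewrite !extE.
Qed.

Lemma null_set_finite_cover A :
  (forall e : R, 0 < e ->
   exists (T : finType) (P : pred T) (a b : T -> I -> 'rV[R]_n),
    [/\ forall t i j, a t i 0 j <= b t i 0 j,
        forall x, A x -> exists2 t, P t & box (a t) (b t) x
      & \sum_(t | P t) box_volume (a t) (b t) <= e]) ->
  null_set A.
Proof.
move=> cov; apply: null_set_countable_cover => e /cov[T [P [a [b [ab Aab le_e]]]]].
exists T, [set` P], a, b; split=> [//|x /Aab[t Pt xt]|]; first by exists t.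
rewrite esum_fset; last 2 first.
- exact: finite_finset.
- by move=> t _; rewrite lee_fin box_volume_ge0.
rewrite fsbig_finite; last exact: finite_finset.
rewrite (_ : (\sum_(_ <- _) _)%E = (\sum_(t | P t) box_volume (a t) (b t))%:E) //.
rewrite sumEFin; congr EFin.
rewrite -[RHS]big_filter; apply: perm_big; apply: uniq_perm => //.
- exact: filter_uniq (index_enum_uniq _).
- move=> t; rewrite in_fset_set ?mem_filter ?mem_index_enum ?andbT;
    last exact: finite_finset.
  by rewrite mem_setE.
Qed.

(** The set with code [k] is covered within [e / 2 ^ (k + 1)], and these bounds sum to at most
    [e]. *)
Lemma null_set_bigcup (T : countType) (A : T -> set (I -> 'rV[R]_n)) :
  (forall t, null_set (A t)) -> null_set (\bigcup_t A t).
Proof.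
move=> nA; apply: null_set_countable_cover => e e0.
have et (t : T) : 0 < e / (2 ^ (choice.pickle t).+1)%:R.
  by rewrite divr_gt0 // ltr0n expn_gt0.
have /choice[D /choice[a /choice[b Dab]]] t := nA t _ (et t).
exists (T * nat)%type, (setT `*`` D).
exists (fun tk => a tk.1 tk.2), (fun tk => b tk.1 tk.2); split.
- by move=> [t k] i j; have [ab _ _] := Dab t; apply: ab.
- move=> x [t _ Atx]; have [_ Aab _] := Dab t.
  by have [k Dk xk] := Aab x Atx; exists (t, k).
rewrite -(@esum_esum _ _ _ setT D (fun t k => (box_volume (a t k) (b t k))%:E));
  last first.
  by move=> t k _ _; have [ab _ _] := Dab t; rewrite lee_fin box_volume_ge0.
apply: (@le_trans _ _ (\esum_(t in [set: T]) (e / (2 ^ (choice.pickle t).+1)%:R)%:E)%E).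
  by apply: le_esum => t _; have [_ _] := Dab t.
rewrite -(esum_image [set: T] choice.pickle
  (fun k => (e / (2 ^ k.+1)%:R)%:E)); last first.
  by move=> s t _ _; apply: (pcan_inj choice.pickleK).
apply: le_trans (epsilon_trick0 xpredT (ltW e0)).
have ek k : (0 <= (e / (2 ^ k.+1)%:R)%:E)%E.
  by rewrite lee_fin divr_ge0 // ltW.
rewrite nneseries_esumT // esum_mkcond.
by apply: le_esum => k _; case: ifP.
Qed.

End NullSets.

(** * Affine dependence on fewer than [n] scalars *)

Section AffineSpanNull.
Variables (R : realType) (n : nat) (I : finType).

Lemma grid_cell (lo d y : R) (N : nat) :
  lo <= y <= lo + N.+1%:R * d ->
  exists k : 'I_N.+1, lo + k%:R * d <= y <= lo + k%:R * d + d.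
Proof.
elim: N => [|N IH].
  by move=> /andP[h1 h2]; exists ord0; rewrite mul0r addr0 h1; rewrite mul1r in h2.
move=> /andP[h1 h2]; have [le_y|lt_y] := lerP y (lo + N.+1%:R * d).
  have [|k hk] := IH; first by rewrite h1.
  by exists (widen_ord (leqnSn _) k).
exists ord_max; rewrite (ltW lt_y) /=.
by move: h2; rewrite -[N.+2%:R]natr1 mulrDl mul1r addrA.
Qed.

Variables (a b : I) (S : {set I}) (v : 'rV[R]_n) (w : I -> 'rV[R]_n).
Hypotheses (ba : b != a) (aS : a \notin S) (cardS : (#|S| < n)%N).

(* Cut the coordinates of the [x i] with [i != a] and the scalars [c s] into [N]
   pieces each. In a cell, [x a] ranges over a box of side [O(1/N)]; there are
   [N ^ ((#|I| - 1) n + #|S|)] cells, of volume [O(N ^ (- #|I| n))], so the total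
   volume is [O(1/N)] because [#|S| < n]. *)
Lemma null_set_bounded_affine_span (M : R) : 0 < M ->
  (forall s j, `|w s 0 j| <= M) ->
  null_set [set x : I -> 'rV[R]_n | (forall i j, `|x i 0 j| <= M) /\
    exists c : I -> R, (forall s, `|c s| <= M) /\
      x a = x b + v + \sum_(s in S) c s *: (x s - x b + w s)].
Proof.
move=> M_gt0 wM; have M0 := M_gt0; apply: null_set_finite_cover => e e0.
(* [K * d] will bound how far [x a] strays from its value at the corner of a cell of side [d]: at
   most [d] through [x b], and [M * (2 * d) + d * (3 * M)] through each summand. *)
pose K : R := 1 + #|I|%:R * (5 * M).
have K0 : 0 < K by rewrite ltr_pwDl // mulr_ge0 // mulr_ge0 // ltW.
(* [C / N] will bound the total volume of the boxes, so [N] is taken at least [C / e]. *)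
pose C : R := (2 * M) ^+ (#|I|.-1 * n) * ((2 * K) ^+ n * (2 * M) ^+ n).
have C0 : 0 <= C by rewrite !mulr_ge0 // exprn_ge0 // mulr_ge0 // ltW.
have [N' hN] : exists N : nat, C / e <= N.+1%:R.
  exists (Num.bound (C / e)); apply: ltW; apply: lt_le_trans (archi_boundP _) _.
    by rewrite divr_ge0 // ltW.
  by rewrite ler_nat.
pose N := N'.+1; pose d : R := 2 * M / N%:R.
have N0 : 0 < N%:R :> R by rewrite ltr0n.
have d0 : 0 < d by rewrite divr_gt0 // mulr_gt0.
have Nd : N%:R * d = 2 * M by rewrite mulrC divfK // gt_eqF.
pose X (f : {ffun I * 'I_n -> 'I_N}) i : 'rV[R]_n := \row_j (- M + (f (i, j))%:R * d).
pose Cg (g : {ffun I -> 'I_N}) s : R := - M + (g s)%:R * d.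
pose Y f g : 'rV[R]_n := X f b + v + \sum_(s in S) Cg g s *: (X f s - X f b + w s).
pose T : finType := ({ffun I * 'I_n -> 'I_N} * {ffun I -> 'I_N})%type.
(* Cell numbers for the coordinates of [x a] and for the scalars outside [S] are frozen at [ord0],
   so that they do not multiply the count of boxes. *)
pose Df : {pred I * 'I_n} := [pred ij | ij.1 != a].
pose P : {pred T} :=
  [predX pffun_on ord0 Df predT & pffun_on ord0 (mem S) predT].
pose lo (t : T) i : 'rV[R]_n :=
  if i == a then Y t.1 t.2 - const_mx (K * d) else X t.1 i.
pose hi (t : T) i : 'rV[R]_n :=
  if i == a then Y t.1 t.2 + const_mx (K * d) else X t.1 i + const_mx d.
exists T, P, lo, hi; split.
- move=> t i j; rewrite /lo /hi; case: ifP => _; rewrite !mxE.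
    by rewrite lerD2l ge0_cp // mulr_ge0 // ltW.
  by rewrite lerDl ltW.
- move=> x [xM [c [cM xa]]].
  have cell y : `|y| <= M ->
      exists k : 'I_N, - M + k%:R * d <= y <= - M + k%:R * d + d.
    rewrite ler_norml => /andP[y1 y2]; apply: grid_cell.
    rewrite y1 /= -/N Nd; lra.
  have /choice[f0 f0P] ij := cell _ (xM ij.1 ij.2).
  have /choice[g0 g0P] s := cell _ (cM s).
  pose f := [ffun ij : I * 'I_n => if ij.1 != a then f0 ij else ord0].
  pose g := [ffun s => if s \in S then g0 s else ord0].
  exists (f, g).
    apply/andP; split; apply/pffun_onP; split => //.
      apply/fintype.subsetP => ij; rewrite !inE ffunE.
      by case: ifP => //; rewrite eqxx.
    apply/fintype.subsetP => s; rewrite !inE ffunE.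
    by case: ifP => //; rewrite eqxx.
  have Xx i j : i != a -> X f i 0 j <= x i 0 j <= X f i 0 j + d.
    by move=> ia; rewrite !mxE ffunE /= ia; apply: (f0P (i, j)).
  have Cc s : s \in S -> Cg g s <= c s <= Cg g s + d.
    by move=> sS; rewrite /Cg ffunE sS; apply: g0P.
  have XM i j : i != a -> `|X f i 0 j| <= M.
    move=> ia; have := Xx i j ia; have := xM i j; rewrite !ler_norml.
    move=> /andP[_ h1] /andP[h2 _]; rewrite (le_trans h2 h1) andbT.
    by rewrite !mxE lerDl mulr_ge0 // ltW.
  move=> i j; rewrite /lo /hi; case: eqP => [->|/eqP ia]; last first.
    by have := Xx i j ia; rewrite !mxE.
  have combE (c' : I -> R) (z : I -> 'rV[R]_n) :
      (z b + v + \sum_(s in S) c' s *: (z s - z b + w s)) 0 j =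
      z b 0 j + v 0 j + \sum_(s in S) c' s * (z s 0 j - z b 0 j + w s 0 j).
    by rewrite !mxE summxE; congr (_ + _); apply: eq_bigr => s _; rewrite !mxE.
  suff : `|x a 0 j - Y f g 0 j| <= K * d.
    rewrite ler_norml !mxE => /andP[h1 h2]; apply/andP; split; lra.
  have -> : x a 0 j - Y f g 0 j = (x b 0 j - X f b 0 j) +
     \sum_(s in S) (c s * (x s 0 j - x b 0 j + w s 0 j) -
                   Cg g s * (X f s 0 j - X f b 0 j + w s 0 j)).
    by rewrite xa /Y !combE sumrB; ring.
  rewrite /K mulrDl mul1r; apply: le_trans (ler_normD _ _) _; apply: lerD.
    by have /andP[h1 h2] := Xx b j ba; rewrite ler_norml; apply/andP; split; lra.
  apply: le_trans (ler_norm_sum _ _ _) _.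
  apply: (@le_trans _ _ (\sum_(s in S) 5 * M * d)).
    apply: ler_sum => s sS.
    have sa : s != a by apply: contraNneq aS => <-.
    have -> : c s * (x s 0 j - x b 0 j + w s 0 j) -
              Cg g s * (X f s 0 j - X f b 0 j + w s 0 j) =
       c s * ((x s 0 j - X f s 0 j) - (x b 0 j - X f b 0 j)) +
       (c s - Cg g s) * (X f s 0 j - X f b 0 j + w s 0 j) by ring.
    apply: le_trans (ler_normD _ _) _; rewrite !normrM.
    have -> : 5 * M * d = M * (2 * d) + d * (3 * M) by ring.
    apply: lerD; apply: ler_pM => //.
    + have /andP[h1 h2] := Xx s j sa; have /andP[h3 h4] := Xx b j ba.
      by rewrite ler_norml; apply/andP; split; lra.
    + have /andP[h1 h2] := Cc s sS.
      by rewrite ler_norml; apply/andP; split; lra.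
    + have := XM s j sa; have := XM b j ba; have := wM s j.
      rewrite !ler_norml => /andP[h1 h2] /andP[h3 h4] /andP[h5 h6].
      by apply/andP; split; lra.
  rewrite sumr_const -[leLHS]mulr_natl -[leRHS]mulrA; apply: ler_wpM2r.
    by rewrite !mulr_ge0 // ltW.
  by rewrite ler_nat max_card.
- have vol t : box_volume (lo t) (hi t) = (2 * K * d) ^+ n * d ^+ (#|I|.-1 * n).
    rewrite /box_volume (bigD1 a) //=; congr (_ * _).
      rewrite /lo /hi eqxx (eq_bigr (fun=> 2 * K * d)).
        by rewrite prodr_const card_ord.
      move=> j _; rewrite !mxE; ring.
    rewrite (eq_bigr (fun=> d ^+ n)).
      by rewrite prodr_const cardC1 -exprM mulnC.
    move=> i ia; rewrite (eq_bigr (fun=> d)) ?prodr_const ?card_ord // => j _.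
    rewrite /lo /hi (negPf ia) !mxE; ring.
  rewrite (eq_bigr (fun=> (2 * K * d) ^+ n * d ^+ (#|I|.-1 * n))) //.
  rewrite (sumr_const P) cardX !card_pffun_on !card_ord.
  have -> : #|Df| = (#|I|.-1 * n)%N.
    have -> : #|Df| = #|[predX (predC1 a) & 'I_n]|.
      by apply: eq_card => -[i j]; rewrite !inE andbT.
    by rewrite cardX cardC1 card_ord.
  rewrite -[leLHS]mulr_natl natrM !natrX.
  have -> : #|mem S| = #|S| by [].
  have -> : N%:R ^+ (#|I|.-1 * n) * N%:R ^+ #|S| *
     ((2 * K * d) ^+ n * d ^+ (#|I|.-1 * n)) =
     (N%:R * d) ^+ (#|I|.-1 * n) * ((2 * K) ^+ n * (N%:R ^+ #|S| * d ^+ n)) :> R.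
    by rewrite !exprMn; ring.
  rewrite Nd.
  apply: (@le_trans _ _ (C / N%:R)); last first.
    by rewrite ler_pdivrMr // mulrC -ler_pdivrMr.
  rewrite /C -!mulrA; apply: ler_wpM2l; first by rewrite exprn_ge0 // mulr_ge0 // ltW.
  apply: ler_wpM2l; first by rewrite exprn_ge0 // mulr_ge0 // ltW.
  rewrite -Nd [(N%:R * d) ^+ n]exprMn ler_pdivlMr // mulrAC ler_pM2r ?exprn_gt0 //.
  (* [#|S| < n] enters here, as [N ^ (#|S| + 1) <= N ^ n]. *)
  by rewrite -exprSr ler_weXn2l // ler1n.
Qed.

Lemma null_set_affine_span :
  null_set [set x : I -> 'rV[R]_n | exists c : I -> R,
     x a = x b + v + \sum_(s in S) c s *: (x s - x b + w s)].
Proof.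
(* The bound on [w] does not involve [x]; placed inside [A M], it makes [A M] empty until [M] is
   large enough. *)
pose A (M : nat) := [set x : I -> 'rV[R]_n |
  (forall s j, `|w s 0 j| <= M.+1%:R) /\ (forall i j, `|x i 0 j| <= M.+1%:R) /\
    exists c : I -> R, (forall s, `|c s| <= M.+1%:R) /\
      x a = x b + v + \sum_(s in S) c s *: (x s - x b + w s)].
apply: (@null_set_sub _ _ _ _ (\bigcup_M A M)); last first.
  apply: null_set_bigcup => M.
  have [wM|nwM] := pselect (forall s j, `|w s 0 j| <= M.+1%:R).
    by apply: null_set_sub (null_set_bounded_affine_span _ wM) => // x [].
  by apply: null_set_sub (@null_set0 _ _ _) => x [/nwM].
move=> x [c xa].
have bound (J : finType) (z : J -> R) : exists M : nat, forall j, `|z j| <= M%:R.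
  exists (Num.bound (\sum_j `|z j|)) => j.
  apply: le_trans (ltW (archi_boundP _)); last exact: sumr_ge0.
  by rewrite (bigD1 j) //= lerDl sumr_ge0.
have [M1 h1] := bound _ (fun sj : I * 'I_n => w sj.1 0 sj.2).
have [M2 h2] := bound _ (fun sj : I * 'I_n => x sj.1 0 sj.2).
have [M3 h3] := bound _ c.
have le_M (m k : nat) y : `|y| <= m%:R :> R -> (m <= k)%N -> `|y| <= k.+1%:R.
  by move=> ym mk; apply: le_trans ym _; rewrite ler_nat ltnW.
exists (M1 + M2 + M3)%N => //; split=> [s j|].
  by apply: le_M (h1 (s, j)) _; rewrite -addnA leq_addr.
split=> [s j|]; first by apply: le_M (h2 (s, j)) _; rewrite addnAC leq_addl.
by exists c; split=> // s; apply: le_M (h3 s) _; rewrite leq_addl.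
Qed.

End AffineSpanNull.

(** * Generic points *)

Section Genericity.
Variables (R : realType) (n : nat) (I : finType).
Implicit Types (x : I -> 'rV[R]_n) (A : {set I}).

Local Notation lat := (of_lattice R).

Lemma of_latticeD (p q : 'rV[int]_n) : lat (p + q) = lat p + lat q.
Proof. exact: raddfD. Qed.

Lemma of_latticeN (p : 'rV[int]_n) : lat (- p) = - lat p.
Proof. exact: raddfN. Qed.

Lemma of_latticeB (p q : 'rV[int]_n) : lat (p - q) = lat p - lat q.
Proof. exact: raddfB. Qed.

Lemma of_lattice0 : lat (0 : 'rV[int]_n) = 0.
Proof. exact: raddf0. Qed.

Lemma of_lattice_inj : injective (@of_lattice R n).
Proof.
move=> p q /matrixP pq; apply/matrixP => i j.
by have := pq i j; rewrite !mxE => /intr_inj.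
Qed.

Lemma affine_combE (V : lmodType R) A (c : I -> R) (z : I -> V) b : b \in A ->
  \sum_(a in A) c a = 1 ->
  \sum_(a in A) c a *: z a = z b + \sum_(a in A :\ b) c a *: (z a - z b).
Proof.
move=> bA c1; rewrite (big_setD1 b) //=.
under [in RHS]eq_bigr => a _ do rewrite scalerBr.
rewrite sumrB -scaler_suml addrCA [RHS]addrC; congr (_ + _).
move/eqP: c1; rewrite (big_setD1 b) //= eq_sym -subr_eq => /eqP <-.
by rewrite scalerBl scale1r.
Qed.

(** Recording the points by a set of indices and one translation each keeps their indices distinct.
    A translate of [x i] is treated by subtracting its translation from every [p a]. *)
Definition affinely_generic x : Prop :=
  forall A (p : I -> 'rV[int]_n) (c : I -> R) i,
    (#|A| <= n)%N -> \sum_(a in A) c a = 1 ->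
    x i = \sum_(a in A) c a *: (x a + lat (p a)) -> i \in A /\ p i = 0.

(* If [x i] is an affine combination violating the condition, then some point is
   a function of the others and of fewer than [n] scalars: [x i] itself when
   [i] is not in [A], and otherwise any [x b] with [b != i] and [c b != 0]. *)
Lemma generically_affinely_generic : generically affinely_generic.
Proof.
(* The exceptional set must be a countable union, so the translations are stored as finite
   functions, which form a countable type. *)
pose T : countType := ({set I} * {ffun I -> 'rV[int]_n} * I * I)%type.
pose B (t : T) : set (I -> 'rV[R]_n) := let: (A, p, i, b) := t in
  if (#|A| <= n)%N && (b \in A) && (b != i) then
    if i \notin A then [set x | exists c : I -> R, x i = x b + lat (p b) +
        \sum_(s in A :\ b) c s *: (x s - x b + (lat (p s) - lat (p b)))]
    (* Here the base point [i] stays in the index set: its summand is a multiple of [- lat (p i)]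
       and absorbs the translation left over after dividing by the coefficient of [b]. *)
    else [set x | exists c : I -> R, x b = x i + (lat (p i) - lat (p b)) +
      \sum_(s in A :\ b) c s *: (x s - x i +
        if s == i then - lat (p i) else lat (p s) - lat (p i))]
  else set0.
apply: (@null_set_sub _ _ _ _ (\bigcup_t B t)); last first.
  apply: null_set_bigcup => -[[[A p] i] b] /=; case: ifP; last first.
    by move=> _; apply: null_set0.
  move=> /andP[/andP[An bA] bi].
  have Ab : (#|A :\ b| < n)%N by move: An; rewrite (cardsD1 b) bA.
  case: ifP => iA; apply: null_set_affine_span => //.
  - by rewrite in_setD1 (negPf iA) andbF.
  - by rewrite eq_sym.
  - by rewrite in_setD1 eqxx.
move=> x; apply: contra_notP => nB A p0 c i An c1.
pose p := [ffun a => p0 a]; have pE a : p0 a = p a by rewrite ffunE.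
under eq_bigr => a _ do rewrite pE.
rewrite pE => xi; have notB b : ~ B (A, p, i, b) x.
  by move=> Bx; apply: nB; exists (A, p, i, b).
have [iA|iA] := boolP (i \in A).
  split=> //; rewrite (affine_combE _ iA c1) in xi.
  (* If every coefficient off [i] vanishes, the relation reduces to [lat (p i) = 0]. *)
  have [[r rA]|c0] := pselect (exists2 r, r \in A :\ i & c r != 0); last first.
    move: xi; rewrite big1 => [|s sA].
      rewrite addr0 -{1}[x i]addr0 => /addrI /esym.
      by rewrite -of_lattice0 => /of_lattice_inj.
    by rewrite [c s](_ : _ = 0) ?scale0r //; apply: contra_notP c0 => /eqP; exists s.
  move=> cr; have /setD1P[ri rA'] := rA.
  case: (notB r); rewrite /B An rA' ri iA /=.
  exists (fun s => if s == i then (c r)^-1 else - (c s / c r)).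
  rewrite (big_setD1 i) /=; last by rewrite in_setD1 eq_sym ri.
  rewrite eqxx subrr add0r.
  move: xi; rewrite (big_setD1 r) //= => xi.
  have -> : A :\ r :\ i = A :\ i :\ r by apply/setP => s; rewrite !inE andbCA.
  set S := \sum_(s in A :\ i :\ r) c s *: (x s + lat (p s) - (x i + lat (p i))) in xi.
  have -> : \sum_(s in A :\ i :\ r)
      (if s == i then (c r)^-1 else - (c s / c r)) *:
      (x s - x i + (if s == i then - lat (p i) else lat (p s) - lat (p i))) =
      - (c r)^-1 *: S.
    rewrite /S scaler_sumr; apply: eq_bigr => s; rewrite !inE => /and3P[_ /negPf -> _].
    rewrite scalerA mulNr [_^-1 * _]mulrC; congr (_ *: _).
    by rewrite opprD addrACA.
  have -> : S = - lat (p i) - c r *: (x r + lat (p r) - (x i + lat (p i))).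
    apply: (@addrI _ (x i + lat (p i) + c r *: (x r + lat (p r) - (x i + lat (p i))))).
    by rewrite -addrA -xi addrACA addrK subrr addr0.
  rewrite scalerBr scalerA mulNr mulVf // scaleN1r scaleNr opprK.
  by rewrite addNKr; apply/rowP => j; rewrite !mxE; ring.
exfalso; have [A0|[b bA]] := set_0Vmem A.
  by move/eqP: c1; rewrite A0 big_set0 eq_sym oner_eq0.
have bi : b != i by apply: contraNneq iA => <-.
case: (notB b); rewrite /B An bA bi iA /=; exists c.
rewrite xi (affine_combE _ bA c1); congr (_ + _); apply: eq_bigr => s _.
by rewrite opprD addrACA.
Qed.

End Genericity.

(** * Exponent sets *)

(** Turns families indexed by the vertices of a simplex into families indexed by [I]; off the image
    of [f] the inverse takes the default [ord0]. *)
Lemma injective_left_inverse k (T : eqType) (f : 'I_k.+1 -> T) :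
  injective f -> exists g : T -> 'I_k.+1, cancel f g.
Proof.
move=> f_inj; exists (fun a => odflt ord0 [pick r | f r == a]) => s.
by case: pickP => [r /eqP/f_inj //|/(_ s)]; rewrite eqxx.
Qed.

Section ExponentChains.
Variables (R : realType) (n : nat) (F : based_seq R n).
Local Notation I := (seq_index F).
Local Notation deg := (@seq_deg R n F).
Implicit Types (i j h : I) (m : 'rV[int]_n).

Lemma diff_exponents_deg i j m : diff_exponents i j m -> deg i = deg j + 1.
Proof. by move=> [ij _]; apply/eqP. Qed.

(** Direct and composite exponents both become chains of positive length. Indexing by [nat] eases
    concatenation, and the degrees along a chain follow from its steps. *)
Lemma exponents_chainP i j m :
  exponents i j m <-> exists (k : nat) (c : nat -> I) (p : nat -> 'rV[int]_n),
    [/\ (0 < k)%N, c 0 = j, c k = i,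
        forall l, (l < k)%N -> diff_exponents (c l.+1) (c l) (p l)
      & m = \sum_(l < k) p l].
Proof.
split=> [[dm|[k [k1 _ [c [p [c0 ck _ cp ->]]]]]]|].
- exists 1%N, (fun l => if l is 0%N then j else i), (fun=> m).
  by split=> // [[]|] //; rewrite big_ord_recl big_ord0 addr0.
- case: k => // k in k1 c p c0 ck cp *.
  exists k.+1, (fun l => c (inord l)), (fun l => p (inord l)); split=> //.
  + by rewrite -c0; congr c; apply/val_inj; rewrite /= inordK.
  + by rewrite -ck; congr c; apply/val_inj; rewrite /= inordK.
  + move=> l lk; have := cp (inord l).
    congr (diff_exponents (c _) (c _) _); apply/val_inj.
      by rewrite /= /bump !inordK // leq0n add1n.
    by rewrite /= !inordK // ltnS ltnW.
  + by apply: eq_bigr => l _; rewrite inord_val.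
move=> [[|[|k]] [c [p [//]]]] _ c0 ck cp ->.
  by left; rewrite big_ord_recl big_ord0 addr0 -c0 -ck; apply: cp.
have degc l : (l <= k.+2)%N -> deg (c l) = deg j + l%:Z.
  elim: l => [|l IH] lk; first by rewrite c0 addr0.
  by rewrite (diff_exponents_deg (cp l lk)) IH ?(ltnW lk) // -addrA -addn1 PoszD.
right; exists k.+2; split=> //; first by rewrite -ck degc.
exists (fun l : 'I_k.+3 => c l), (fun l : 'I_k.+2 => p l); split=> //.
  by move=> l; apply: degc; rewrite -ltnS.
by move=> l; have := cp l (ltn_ord l).
Qed.

Lemma exponents_deg i j m : exponents i j m -> deg j < deg i.
Proof.
move=> /exponents_chainP[[|k] [c [p [//]]]] _ <- <- cp _.
elim: k cp => [|k IH] cp; rewrite (diff_exponents_deg (cp _ (ltnSn _))) ?ltrDl //.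
by apply: lt_trans (IH _) _; rewrite ?ltrDl // => l lk; apply: cp; apply: ltnW.
Qed.

(** The two chains are concatenated at [j], the end of one and the start of the other. *)
Lemma exponents_trans i j h m m' :
  exponents j i m -> exponents h j m' -> exponents h i (m + m').
Proof.
move=> /exponents_chainP[k [c [p [k0 c0 ck cp ->]]]].
move=> /exponents_chainP[k' [c' [p' [k0' c0' ck' cp' ->]]]].
apply/exponents_chainP; exists (k + k')%N.
exists (fun l => if (l <= k)%N then c l else c' (l - k)%N).
exists (fun l => if (l < k)%N then p l else p' (l - k)%N); split.
- by rewrite addn_gt0 k0.
- by [].
- by rewrite -leq_subRL // subnn leqNgt k0' /= addKn.
- move=> l lk; have [lk'|kl] := ltnP l k; first by rewrite (ltnW lk'); apply: cp.
  rewrite subSn //; have := cp' (l - k)%N; rewrite ltn_subLR // => /(_ lk).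
  have [lk'|//] := leqP l k; have -> : l = k by apply/eqP; rewrite eqn_leq lk'.
  by rewrite subnn c0' ck.
- rewrite big_split_ord /=; congr (_ + _); apply: eq_bigr => l _.
    by rewrite ltn_ord.
  by rewrite ltnNge leq_addr /= addKn.
Qed.

Definition partial_sum k (m : 'I_k -> 'rV[int]_n) (j : 'I_k.+1) : 'rV[int]_n :=
  \sum_(l < k | (l < j)%N) m l.

Lemma partial_sum_next k (m : 'I_k -> 'rV[int]_n) l :
  partial_sum m (next_index l) = partial_sum m (prev_index l) + m l.
Proof.
rewrite /partial_sum (bigD1 l) /=; last by rewrite /bump leq0n add1n ltnSn.
rewrite addrC; congr (_ + _); apply: eq_bigl => s.
by rewrite /bump leq0n add1n ltnS andbC -ltn_neqAle.
Qed.

Lemma partial_sum0 k (m : 'I_k -> 'rV[int]_n) : partial_sum m ord0 = 0.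
Proof. exact: big_pred0. Qed.

Definition exponent_chain k (i : 'I_k.+1 -> I) (m : 'I_k -> 'rV[int]_n) :=
  forall l, exponents (i (next_index l)) (i (prev_index l)) (m l).

(** By transitivity every edge of a simplex of X(F) is an edge of X(F), not only those between
    consecutive vertices. *)
Lemma exponents_simplex k (i : 'I_k.+1 -> I) (m : 'I_k -> 'rV[int]_n) :
  exponent_chain i m -> forall r r' : 'I_k.+1, (r < r')%N ->
    exponents (i r') (i r) (partial_sum m r' - partial_sum m r).
Proof.
move=> Em r [r' hr']; elim: r' hr' => //= r' IH hr' rr'.
pose l := Ordinal (hr' : (r' < k)%N).
have -> : Ordinal hr' = next_index l by apply: val_inj; rewrite /= /bump leq0n.
rewrite partial_sum_next; have := Em l; rewrite leq_eqVlt eqSS in rr'.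
have [rE _|nr El] := eqVneq (r : nat) r'.
  have -> : r = prev_index l by apply: val_inj.
  by rewrite addrAC subrr add0r.
have hr : (r' < k.+1)%N by apply: ltnW.
have := IH hr; rewrite ltn_neqAle nr -ltnS.
rewrite (negPf nr) /= in rr'; rewrite ltnS in rr'.
have -> : Ordinal hr = prev_index l by apply: val_inj.
by move=> /(_ (ltnW rr')) Er; rewrite addrAC; apply: exponents_trans Er El.
Qed.

Lemma exponent_chain_deg k (i : 'I_k.+1 -> I) (m : 'I_k -> 'rV[int]_n) :
  exponent_chain i m -> forall r r' : 'I_k.+1, (r < r')%N -> deg (i r) < deg (i r').
Proof. by move=> im r r' /(exponents_simplex im); apply: exponents_deg. Qed.

Lemma exponent_chain_inj k (i : 'I_k.+1 -> I) (m : 'I_k -> 'rV[int]_n) :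
  exponent_chain i m -> injective i.
Proof.
move=> im r r' irr'; have degi := exponent_chain_deg im; apply: val_inj.
have [/degi|/degi|//] := ltngtP r r'; by rewrite irr' ltxx.
Qed.

End ExponentChains.

(** * Simplices *)

Section Simplices.
Variables (R : realType) (n : nat) (F : based_seq R n).
Local Notation I := (seq_index F).
Local Notation deg := (@seq_deg R n F).
Local Notation lat := (of_lattice R).
Variable x : I -> 'rV[R]_n.

Lemma torus_proj_eqP (y z : 'rV[R]_n) :
  torus_proj y = torus_proj z <-> exists m, y = z + lat m.
Proof.
split=> [e|yz]; last by apply/eqmodP/asboolP.
by apply/asboolP; apply/(@eqmodP _ (lattice_equiv_rel R n)); exact: e.
Qed.

Lemma simplex_rangeP k (y : 'I_k.+1 -> 'rV[R]_n) q :
  range (simplex y) q <-> exists t : 'rV[R]_k.+1,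
    [/\ forall j, 0 <= t 0 j, \sum_j t 0 j = 1
      & q = torus_proj (\sum_j t 0 j *: y j)].
Proof.
split=> [[t _ <-]|[t [t0 t1 ->]]].
  by exists (val t); have := valP t; rewrite inE => -[].
have tS : t \in std_simplex R k by rewrite inE.
by exists (exist _ t tS).
Qed.

Definition simplex_vertex k (i : 'I_k.+1 -> I) (m : 'I_k -> 'rV[int]_n)
    (j : 'I_k.+1) : 'rV[R]_n := x (i j) + lat (partial_sum m j).

Lemma complex_imageP q :
  complex_image x q <-> exists k (i : 'I_k.+1 -> I) (m : 'I_k -> 'rV[int]_n),
    exponent_chain i m /\ range (simplex (simplex_vertex i m)) q.
Proof.
split=> [[k _ [s [i [m [im ->]]] sq]]|[k [i [m [im sq]]]]].
  by exists k, i, m.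
by exists k => //; exists (simplex (simplex_vertex i m)) => //; exists i, m.
Qed.

(** * Interior of a nondegenerate [n]-simplex in the torus *)

Section TopSimplex.
Variable y : 'I_n.+1 -> 'rV[R]_n.

(* A leading coordinate 1 turns barycentric coordinates into linear ones. *)
Definition homogeneous (z : 'rV[R]_n) : 'rV[R]_n.+1 :=
  \row_j oapp (z 0) 1 (unlift ord0 j).

Definition homogeneous_vertices : 'M[R]_n.+1 := \matrix_r homogeneous (y r).

Lemma mul_homogeneous_vertices (t : 'rV[R]_n.+1) (z : 'rV[R]_n) :
  t *m homogeneous_vertices = homogeneous z <->
  \sum_r t 0 r = 1 /\ \sum_r t 0 r *: y r = z.
Proof.
have E0 : (t *m homogeneous_vertices) 0 ord0 = \sum_r t 0 r.
  by rewrite mxE; apply: eq_bigr => r _; rewrite !mxE unlift_none mulr1.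
have Ej j : (t *m homogeneous_vertices) 0 (lift ord0 j) = (\sum_r t 0 r *: y r) 0 j.
  by rewrite mxE summxE; apply: eq_bigr => r _; rewrite !mxE liftK.
split=> [tz|[t1 tz]].
  split; first by rewrite -E0 tz mxE unlift_none.
  by apply/rowP => j; rewrite -Ej tz mxE liftK.
apply/rowP => j; have [j'|] := unliftP ord0 j => ->.
  by rewrite Ej tz mxE liftK.
by rewrite E0 t1 mxE unlift_none.
Qed.

(** A nonzero kernel vector has entries of sum 0, by the leading column, and gives a linear relation
    among the [y r]; dividing by a nonzero entry solves for its vertex. *)
Lemma singular_vertices : homogeneous_vertices \notin unitmx ->
  exists r (c : 'I_n.+1 -> R),
    \sum_(s | s != r) c s = 1 /\ y r = \sum_(s | s != r) c s *: y s.
Proof.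
rewrite unitmxE unitfE negbK => /det0P[u u0 uN].
have u1 : \sum_r u 0 r = 0.
  have := congr1 (fun v : 'rV_n.+1 => v 0 ord0) uN.
  rewrite !mxE => uN0; rewrite -[RHS]uN0.
  by apply: eq_bigr => r _; rewrite !mxE unlift_none mulr1.
have uy : \sum_r u 0 r *: y r = 0.
  apply/rowP => j; have := congr1 (fun v : 'rV_n.+1 => v 0 (lift ord0 j)) uN.
  rewrite !mxE => uNj; rewrite -[RHS]uNj summxE.
  by apply: eq_bigr => r _; rewrite !mxE liftK.
have [r ur] : exists r, u 0 r != 0 by apply/rV0Pn.
exists r, (fun s => - (u 0 s / u 0 r)); split.
  rewrite sumrN -mulr_suml -mulNr; apply: (canLR (mulfK ur)); rewrite mul1r.
  by move/eqP: u1; rewrite (bigD1 r) //= addr_eq0 => /eqP ->.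
rewrite (eq_bigr (fun s => - (u 0 r)^-1 *: (u 0 s *: y s))); last first.
  by move=> s _; rewrite scalerA mulNr mulrC.
rewrite -scaler_sumr; move/eqP: uy; rewrite (bigD1 r) //= addrC addr_eq0 => /eqP ->.
by rewrite scalerN scaleNr opprK scalerA mulVf // scale1r.
Qed.

(** The barycentric coordinates [g r] are affine, hence continuous, so the points where all of them
    are positive form an open set; it contains the barycentre [z0]. *)
Lemma interior_simplex : homogeneous_vertices \in unitmx ->
  interior (range (simplex y)) !=set0.
Proof.
move=> Nunit; pose B := invmx homogeneous_vertices.
pose g (r : 'I_n.+1) (z : 'rV[R]_n) : R := (homogeneous z *m B) 0 r.
have gcont r : continuous (g r).
  have -> : g r = cst (B ord0 r) \+ fun z => \sum_j z 0 j * B (lift ord0 j) r.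
    apply/funext => z; rewrite /g mxE big_ord_recl !mxE unlift_none mul1r.
    by congr (_ + _); apply: eq_bigr => j _; rewrite !mxE liftK.
  move=> z; apply: continuousD; first exact: cst_continuous.
  apply: continuous_big => [uv|j _ z'].
    by apply: continuousD; [exact: cvg_fst|exact: cvg_snd].
  apply: (@continuousM _ _ (fun z'' : 'rV_n => z'' 0 j) (cst (B (lift ord0 j) r))).
    exact: coord_continuous.
  exact: cst_continuous.
(* Closing under lattice translations makes [U] the full preimage of its image, which is therefore
   open in the quotient topology. *)
pose U : set 'rV[R]_n := [set z | exists m, forall r, 0 < g r (z + lat m)].
have Uopen : open U.
  rewrite openE => z [m gz]; rewrite /interior /=.
  suff : \forall z' \near z, forall r, 0 < g r (z' + lat m).
    by apply: filterS => z' gz'; exists m.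
  apply: (@filter_forall _ 'I_n.+1 (fun r z' => 0 < g r (z' + lat m))
    (nbhs z) (nbhs_filter z)) => r.
  have gm : {for z, continuous (g r \o (fun z' => z' + lat m))}.
    apply: continuous_comp; last exact: gcont.
    by apply: continuousD; [exact: cvg_id|exact: cst_continuous].
  exact: (cvgr_gt _ gm _ (gz r)).
pose z0 := \sum_r (n.+1%:R)^-1 *: y r.
have gz0 r : g r z0 = n.+1%:R^-1.
  rewrite /g (_ : homogeneous z0 = const_mx n.+1%:R^-1 *m homogeneous_vertices).
    by rewrite mulmxK // mxE.
  apply/esym/mul_homogeneous_vertices; split.
    under eq_bigr => s _ do rewrite mxE.
    by rewrite sumr_const card_ord -[LHS]mulr_natl mulfV // pnatr_eq0.
  by apply: eq_bigr => s _; rewrite mxE.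
have Vopen : open (@torus_proj R n @` U).
  rewrite /open /= /quotient_open.
  rewrite (_ : _ @^-1` _ = U) //; apply/seteqP; split=> z /=; last by exists z.
  move=> [z' [m gm] /torus_proj_eqP[q zq]]; exists (q + m) => r.
  by rewrite of_latticeD addrA -zq.
exists (torus_proj z0); suff: @torus_proj R n @` U `<=` interior (range (simplex y)).
  apply; exists z0 => //; exists 0 => r.
  by rewrite of_lattice0 addr0 gz0 invr_gt0.
rewrite -open_subsetE //.
move=> _ [z [m gz] <-]; apply/simplex_rangeP.
pose t := homogeneous (z + lat m) *m B.
have /mul_homogeneous_vertices[t1 ty] :
    t *m homogeneous_vertices = homogeneous (z + lat m).
  by rewrite mulmxKV.
exists t; split=> // [j|]; first exact: ltW (gz j).
rewrite ty; apply/torus_proj_eqP; exists (- m).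
by rewrite of_latticeN addrK.
Qed.

End TopSimplex.

Hypothesis xgen : affinely_generic x.
Hypothesis Tint : interior (complex_image x) = set0.

(** Otherwise the first [n + 1] vertices would span an [n]-simplex in T(F), nondegenerate by
    genericity, and T(F) would have interior points. *)
Lemma exponent_chain_dim k (i : 'I_k.+1 -> I) (m : 'I_k -> 'rV[int]_n) :
  exponent_chain i m -> (k < n)%N.
Proof.
move=> im; rewrite ltnNge; apply/negP => nk.
pose i' (r : 'I_n.+1) := i (widen_ord (nk : n < k.+1)%N r).
pose m' (l : 'I_n) := m (widen_ord nk l).
have im' : exponent_chain i' m'.
  move=> l; have := im (widen_ord nk l).
  by congr (exponents (i _) (i _) _); apply: val_inj.
pose y := simplex_vertex i' m'.
have [Nunit|/singular_vertices[r [c [c1 yr]]]] :=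
    boolP (homogeneous_vertices y \in unitmx).
  have [q qint] := interior_simplex Nunit.
  suff : interior (complex_image x) q by rewrite Tint.
  apply: filterS qint => q' yq'; apply/complex_imageP.
  by exists n, i', m'.
have i'inj := exponent_chain_inj im'.
have [inv invK] := injective_left_inverse i'inj.
have imE (V : nmodType) (f : I -> V) :
    \sum_(a in [set i' s | s in [set~ r]]%SET) f a = \sum_(s | s != r) f (i' s).
  rewrite big_imset /=; last by move=> ? ? _ _; apply: i'inj.
  by apply: eq_bigl => s; rewrite !inE.
(* Subtracting the translation of vertex [r] exhibits [x (i' r)] as an affine combination of [n]
   points whose indices differ from [i' r]. *)
have [] := xgen (A := [set i' s | s in [set~ r]]%SET)
  (p := fun a => partial_sum m' (inv a) - partial_sum m' r)
  (c := fun a => c (inv a)) (i := i' r).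
- by rewrite card_imset // cardsC1 card_ord.
- by rewrite imE; under eq_bigr => s _ do rewrite invK.
- rewrite imE; under eq_bigr => s _ do
    rewrite invK of_latticeB addrA -/(simplex_vertex i' m' s) scalerBr.
  rewrite sumrB -scaler_suml c1 scale1r -yr /y /simplex_vertex.
  by rewrite addrK.
by move=> /imsetP[s]; rewrite !inE => sr /i'inj rs; rewrite rs eqxx in sr.
Qed.

(* Vertices of a simplex have distinct indices, so a lifted simplex is recorded
   by the set [A] of its indices and the translation [p a] of each vertex. *)
Lemma complex_image_cell z : complex_image x (torus_proj z) ->
  exists (A : {set I}) (p : {ffun I -> 'rV[int]_n}) (c : I -> R),
    [/\ (#|A| <= n)%N,
        forall a b, a \in A -> b \in A -> deg a < deg b -> exponents b a (p b - p a),
        \sum_(a in A) c a = 1 & z = \sum_(a in A) c a *: (x a + lat (p a))].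
Proof.
move=> /complex_imageP[k [i [m [im /simplex_rangeP[t [_ t1 /torus_proj_eqP[q zq]]]]]]].
have iinj := exponent_chain_inj im.
have [inv invK] := injective_left_inverse iinj.
have imE (V : nmodType) (f : I -> V) :
    \sum_(a in [set i s | s in 'I_k.+1]%SET) f a = \sum_s f (i s).
  by rewrite big_imset //= => ? ? _ _; apply: iinj.
(* The shift [q] carries the simplex to the lift containing [z]; it cancels in the differences of
   translations. *)
exists [set i s | s in 'I_k.+1]%SET, [ffun a => partial_sum m (inv a) + q].
exists (fun a => t 0 (inv a)); split.
- by rewrite card_imset // card_ord; apply: exponent_chain_dim im.
- move=> _ _ /imsetP[r _ ->] /imsetP[s _ ->] deg_rs.
  rewrite !ffunE !invK opprD addrACA subrr addr0.
  apply: (exponents_simplex im); have degi := exponent_chain_deg im.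
  have [//|/degi sr|/val_inj sr] := ltngtP r s; last by rewrite sr ltxx in deg_rs.
  by rewrite ltNge (ltW sr) in deg_rs.
- by rewrite imE; under eq_bigr => s _ do rewrite invK.
- rewrite imE zq; under [RHS]eq_bigr => s _ do
    rewrite ffunE invK of_latticeD addrA scalerDr.
  by rewrite big_split /= -scaler_suml t1 scale1r.
Qed.

End Simplices.

(** * Edges *)

Section Edges.
Variables (R : realType) (n : nat) (F : based_seq R n).
Local Notation I := (seq_index F).
Local Notation deg := (@seq_deg R n F).
Local Notation lat := (of_lattice R).
Variable x : I -> 'rV[R]_n.
Hypothesis xgen : affinely_generic x.
Hypothesis Tint : interior (complex_image x) = set0.

Definition edge_point (i j : I) (m : 'rV[int]_n) (t : R) : 'rV[R]_n :=
  x i + t *: (x j + lat m - x i).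

Lemma unit_interval_uncountable : ~ countable (`[0, 1] : set R).
Proof.
move=> /countable_lebesgue_measure0 /eqP.
by rewrite lebesgue_measure_itv /= lte_fin ltr01 oppr0 adde0 onee_eq0.
Qed.

(** Two points of the edge share a cell, and genericity makes [i] and [j] vertices of that cell,
    with translations 0 and [m]. The edge is then a face of a simplex of X(F). *)
Lemma exponents_of_edge i j m : deg i < deg j ->
  (forall t, 0 <= t <= 1 -> complex_image x (torus_proj (edge_point i j m t))) ->
  exponents j i m.
Proof.
move=> deg_ij edgeT.
pose good (t : R) (Ap : {set I} * {ffun I -> 'rV[int]_n}) := exists c : I -> R,
  [/\ (#|Ap.1| <= n)%N,
      forall a b, a \in Ap.1 -> b \in Ap.1 -> deg a < deg b ->
        exponents b a (Ap.2 b - Ap.2 a),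
      \sum_(a in Ap.1) c a = 1
    & edge_point i j m t = \sum_(a in Ap.1) c a *: (x a + lat (Ap.2 a))].
have /choice[Ap ApP] t : exists Ap, 0 <= t <= 1 -> good t Ap.
  have [t01|nt] := pselect (0 <= t <= 1); last by exists (finset.set0, [ffun=> 0]).
  have [A [p [c Apc]]] := complex_image_cell xgen Tint (edgeT t t01).
  by exists (A, p) => _; exists c.
(* There are only countably many cells. *)
have [t [t' [t01 t'01 tt' Apt]]] : exists t t',
    [/\ 0 <= t <= 1, 0 <= t' <= 1, t != t' & Ap t = Ap t'].
  apply: contrapT => nAp; apply: unit_interval_uncountable.
  apply/countable_injP; exists (choice.pickle \o Ap) => t t'.
  rewrite !inE /= !in_itv /= => t01 t'01 /(pcan_inj choice.pickleK) Apt.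
  by apply: contrapT => /eqP tt'; apply: nAp; exists t, t'.
have [c [An cellA c1 zt]] := ApP t t01.
have [c' [_ _ c'1 zt']] := ApP t' t'01; rewrite -Apt in c'1 zt'.
case: (Ap t) An cellA c1 zt c'1 zt' => A p /= An cellA c1 zt c'1 zt'.
pose d := t' - t; have d0 : d != 0 by rewrite subr_eq0 eq_sym.
(* The two points span the line through the edge, so both of its endpoints are
   affine combinations of the vertices of the cell. *)
have endpoint (u v : R) (k : I) (s : 'rV[int]_n) :
    u + v = d ->
    u *: edge_point i j m t + v *: edge_point i j m t' = d *: (x k + lat s) ->
    k \in A /\ p k = s.
  (* Genericity is applied after subtracting [s] from every translation. *)
  move=> uv ek; have [] := xgen (p := fun a => p a - s)
      (c := fun a => (u * c a + v * c' a) / d) (i := k) An.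
  - by rewrite -mulr_suml big_split /= -!mulr_sumr c1 c'1 !mulr1 uv mulfV.
  - apply: (@addIr _ (lat s)).
    apply: (scalerI d0); rewrite -ek zt zt' !scaler_sumr -big_split /=.
    rewrite scalerDr scaler_sumr.
    have -> : d *: lat s = \sum_(a in A) (u * c a + v * c' a) *: lat s.
      by rewrite -scaler_suml big_split /= -!mulr_sumr c1 c'1 !mulr1 uv.
    rewrite -big_split /=; apply: eq_bigr => a _.
    rewrite [d *: _]scalerA [d * _]mulrC divfK // -scalerDr of_latticeB.
    by rewrite addrA subrK !scalerA scalerDl.
  by move=> kA /eqP; rewrite subr_eq0 => /eqP.
(* With [P t] the point of the edge at [t], [t' P t - t P t' = d x_i] and [(1 - t) P t' - (1 - t') P
   t = d (x_j + m)]. *)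
have [iA pi] : i \in A /\ p i = 0.
  apply: (endpoint t' (- t)) => //.
  rewrite of_lattice0 /edge_point /d.
  by apply/rowP => l; rewrite !mxE; ring.
have [jA pj] : j \in A /\ p j = m.
  apply: (endpoint (- (1 - t')) (1 - t)) => //; first by rewrite /d; ring.
  rewrite /edge_point /d.
  by apply/rowP => l; rewrite !mxE; ring.
by have := cellA i j iA jA deg_ij; rewrite pi pj subr0.
Qed.

(** Expresses the exponents through T(F), the degrees and the lifts [x] alone, as the recovery
    requires. Forward, the edge is itself a 1-simplex of X(F). *)
Lemma exponents_edgeP i j m : exponents j i m <-> deg i < deg j /\
  forall t, 0 <= t <= 1 -> complex_image x (torus_proj (edge_point i j m t)).
Proof.
split=> [Eij|[]]; last exact: exponents_of_edge.
split=> [|t /andP[t0 t1]]; first exact: exponents_deg Eij.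
pose v (r : 'I_2) := if r == ord0 then i else j.
apply/complex_imageP; exists 1%N, v, (fun=> m); split.
  by move=> l; rewrite /v /= (ord1 l).
apply/simplex_rangeP; exists (\row_r if r == ord0 then 1 - t else t); split.
- by move=> r; rewrite mxE; case: ifP => _ //; rewrite subr_ge0.
- by rewrite !big_ord_recl big_ord0 !mxE /= addr0 subrK.
- congr torus_proj; rewrite !big_ord_recl big_ord0 !mxE /= /simplex_vertex /v /=.
  have := partial_sum_next (fun=> m) (ord0 : 'I_1).
  have -> : prev_index (ord0 : 'I_1) = ord0 by apply: val_inj.
  rewrite partial_sum0 add0r => ->; rewrite of_lattice0 /edge_point.
  by apply/rowP => l; rewrite !mxE; ring.
Qed.

(** A vertex of degree 0 exists and is a 0-simplex of X(F), whose dimension must be below [n]. *)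
Lemma lattice_dim_gt0 : (0 < n)%N.
Proof.
have [i _] := seq_deg0 F.
by apply: (@exponent_chain_dim _ _ _ x xgen Tint 0 (fun=> i) (fun=> 0)) => -[].
Qed.

(** Genericity is applied to the singleton of [j], which has at most [n] elements because [n] is
    positive. *)
Lemma vertex_inj i j : torus_proj (x i) = torus_proj (x j) -> i = j.
Proof.
move=> /torus_proj_eqP[m xij].
have [] := xgen (A := [set j]%SET) (p := fun=> m) (c := fun=> 1) (i := i).
- by rewrite cards1 lattice_dim_gt0.
- by rewrite big_set1.
- by rewrite big_set1 scale1r.
- by rewrite inE => /eqP.
Qed.

Lemma complex_image0P q : complex_image0 x q <-> exists i, q = torus_proj (x i).
Proof.
split=> [[s [i [m [_ ->]]] /simplex_rangeP[t [_ t1 ->]]]|[i ->]].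
  exists (i ord0); congr torus_proj; rewrite big_ord_recl big_ord0 addr0.
  move: t1; rewrite big_ord_recl big_ord0 addr0 => ->.
  by rewrite scale1r big_ord0 of_lattice0 addr0.
exists (simplex (simplex_vertex x (fun _ : 'I_1 => i) (fun=> 0))).
  by exists (fun=> i), (fun=> 0); split => // -[].
apply/simplex_rangeP; exists (const_mx 1); split.
- by move=> r; rewrite mxE.
- by rewrite big_ord_recl big_ord0 mxE addr0.
- congr torus_proj; rewrite big_ord_recl big_ord0 mxE addr0 scale1r.
  by rewrite /simplex_vertex partial_sum0 of_lattice0 addr0.
Qed.

(** Passes between translations of the vertices and the successive differences that [complex_of]
    uses. *)
Lemma partial_sum_telescope k (M : 'I_k.+1 -> 'rV[int]_n) : M ord0 = 0 ->
  partial_sum (fun l => M (next_index l) - M (prev_index l)) =1 M.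
Proof.
move=> M0 [r hr]; elim: r hr => [|r IH] hr.
  by rewrite (_ : Ordinal hr = ord0) ?partial_sum0 //; apply: val_inj.
pose l := Ordinal (hr : (r < k)%N).
have -> : Ordinal hr = next_index l by apply: val_inj.
have prevE : prev_index l = Ordinal (ltnW hr : (r < k.+1)%N) by apply: val_inj.
by rewrite partial_sum_next prevE IH addrC subrK.
Qed.

(** Backward, the edges between consecutive vertices lie in the image of [sigma], hence in T(F), and
    [exponents_of_edge] applies to each of them. *)
Lemma simplex_complexP k (i : 'I_k.+1 -> I) (mbar : 'I_k -> 'rV[int]_n) :
  let sigma := simplex (fun j => x (i j) + lat (oapp mbar 0 (unlift ord0 j))) in
  complex_of x k sigma <->
    (forall l : 'I_k, deg (i (prev_index l)) < deg (i (next_index l))) /\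
    range sigma `<=` complex_image x.
Proof.
pose M (j : 'I_k.+1) := oapp mbar 0 (unlift ord0 j).
rewrite -/(M _) /=; split=> [sX|[degi sT]].
  split; last by move=> q sq; exists k => //; eexists; [exact: sX|].
  (* Membership only gives an equality of maps to the torus, for possibly other indices [i'];
     evaluation at the vertices identifies them with [i]. *)
  have [i' [m' [im' sE]]] := sX.
  suff ii' r : i r = i' r.
    by move=> l; rewrite !ii'; apply: (exponent_chain_deg im').
  apply: vertex_inj; apply/torus_proj_eqP.
  pose t : 'rV[R]_k.+1 := delta_mx 0 r.
  have tsum (z : 'I_k.+1 -> 'rV[R]_n) : \sum_j t 0 j *: z j = z r.
    rewrite (bigD1 r) //= mxE !eqxx scale1r big1 ?addr0 // => s sr.
    by rewrite mxE (negPf sr) andbF scale0r.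
  have tS : t \in std_simplex R k.
    rewrite inE; split=> [j|]; first by rewrite mxE.
    rewrite (bigD1 r) //= mxE !eqxx big1 ?addr0 // => s sr.
    by rewrite mxE (negPf sr) andbF.
  have := congr1 (fun s => s (exist _ t tS)) sE.
  rewrite /simplex /= !tsum => /torus_proj_eqP[q xq].
  exists (partial_sum m' r + q - M r).
  by rewrite of_latticeB of_latticeD !addrA -xq addrK.
exists i, (fun l => M (next_index l) - M (prev_index l)); split; last first.
  congr simplex; apply/funext => j; congr (_ + lat _).
  by rewrite -[RHS]/(partial_sum _ j) partial_sum_telescope // /M unlift_none.
move=> l; apply: exponents_of_edge => // t /andP[t0 t1]; apply: sT.
apply/simplex_rangeP.
have lr : prev_index l != next_index l by rewrite -val_eqE /= ltn_eqF.
have pick_sum (V : nmodType) (z : 'I_k.+1 -> V) :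
    (forall r, r != prev_index l -> r != next_index l -> z r = 0) ->
    \sum_r z r = z (prev_index l) + z (next_index l).
  move=> z0; rewrite (bigD1 (prev_index l)) //=.
  rewrite (bigD1 (next_index l)) /=; last by rewrite eq_sym.
  by rewrite big1 ?addr0 // => r /andP[]; apply: z0.
exists (\row_r if r == prev_index l then 1 - t
                else if r == next_index l then t else 0); split.
- by move=> r; rewrite mxE; do 2?case: ifP => _ //; rewrite subr_ge0.
- rewrite pick_sum => [|r /negPf rp /negPf rn]; last by rewrite mxE rp rn.
  by rewrite !mxE [next_index l == _]eq_sym (negPf lr) !eqxx subrK.
- rewrite pick_sum => [|r /negPf rp /negPf rn]; last first.
    by rewrite mxE rp rn scale0r.
  rewrite !mxE [next_index l == _]eq_sym (negPf lr) !eqxx.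
  (* [edge_point] starts at an untranslated point, so the edge is moved back by the translation of
     its first vertex. *)
  apply/torus_proj_eqP; exists (- M (prev_index l)).
  rewrite -/(M _) -/(M _) /edge_point of_latticeB of_latticeN.
  move: (lat (M _)) (lat (M _)) => a b.
  by apply/rowP => s; rewrite !mxE; ring.
Qed.

End Edges.

(** * Recovering the discrete information *)

Section Recovery.
Variables (R : realType) (n : nat).
Local Notation lat := (of_lattice R).

(** Shifts at single indices, one for each element of [I], compose to an arbitrary family of
    shifts. *)
Lemma info_equiv_shift (I : finType) (deg : I -> int)
    (E : I -> I -> set 'rV[int]_n) (s : I -> 'rV[int]_n) :
  info_equiv (DiscreteInfo deg E)
    (DiscreteInfo deg (fun a b => [set p + s a - s b | p in E a b])).
Proof.
(* Only the indices in [r] are shifted; [uniq r] ensures that none is shifted twice. *)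
pose sr (r : seq I) a : 'rV[int]_n := if a \in r then s a else 0.
suff shift r : uniq r -> info_equiv (DiscreteInfo deg E)
    (DiscreteInfo deg (fun a b => [set p + sr r a - sr r b | p in E a b])).
  have := shift _ (enum_uniq I); congr (info_equiv _ (DiscreteInfo deg _)).
  by apply/funext => a; apply/funext => b; rewrite /sr !mem_enum.
elim: r => [_|i r IH /= /andP[ir /IH Er]].
  rewrite [X in info_equiv _ (DiscreteInfo deg X)](_ : _ = E).
    exact: rt_refl.
  apply/funext => a; apply/funext => b; rewrite /sr /=.
  by under eq_imagel => p _ do rewrite addr0 subr0; rewrite image_id.
apply: rt_trans Er _; have := @InfoShift n I deg
  (fun a b => [set p + sr r a - sr r b | p in E a b]) i (s i).
move=> /(rt_step _ _ _ _); congr (info_equiv _ (DiscreteInfo deg _)).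
apply/funext => a; apply/funext => b; rewrite image_comp.
apply: eq_imagel => p _ /=.
have srE c : sr (i :: r) c = sr r c + (if c == i then s i else 0).
  rewrite /sr inE; case: eqP => [->|_] /=; last by rewrite addr0.
  by rewrite (negPf ir) add0r.
by rewrite !srE opprD [in RHS]addrA -!addrA; congr (_ + (_ + _)); rewrite addrCA.
Qed.

Variables (F F' : based_seq R n).
Variables (x : seq_index F -> 'rV[R]_n) (x' : seq_index F' -> 'rV[R]_n).
Hypotheses (xgen : affinely_generic x) (x'gen : affinely_generic x').
Hypothesis Tint : interior (complex_image x) = set0.
Hypothesis TT' : complex_image x' = complex_image x.
Hypothesis T0T0' : complex_image0 x' = complex_image0 x.
Hypothesis degE : forall i i',
  torus_proj (x i) = torus_proj (x' i') -> seq_deg i = seq_deg i'.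

(** The points of T_0 match the two index sets through [f], and [s] records how the lifts differ.
    Shifting by [s], then transferring along [f], carries one family of exponent sets to the
    other. *)
Lemma info_equiv_of_image : info_equiv (info_of F') (info_of F).
Proof.
have T'int : interior (complex_image x') = set0 by rewrite TT'.
have /choice[f fP] i' : exists i, torus_proj (x' i') = torus_proj (x i).
  by apply/complex_image0P; rewrite -T0T0'; apply/complex_image0P; exists i'.
have /choice[g gP] i : exists i', torus_proj (x i) = torus_proj (x' i').
  by apply/complex_image0P; rewrite T0T0'; apply/complex_image0P; exists i.
have /choice[s sP] i' : exists m, x' i' = x (f i') + lat m.
  by apply/torus_proj_eqP.
have fbij : bijective f.
  exists g => [i'|i]; first by apply: (vertex_inj x'gen T'int); rewrite -gP -fP.
  by apply: (vertex_inj xgen Tint); rewrite -fP -gP.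
have degf i' : seq_deg (f i') = seq_deg i' by apply: degE; rewrite fP.
apply: rt_trans (info_equiv_shift _ _ s) _; apply: rt_step.
apply: (InfoTransfer (f := f)) => // a b; apply/seteqP.
(* The two edges differ by the translation [s b]. *)
have pointE m t : torus_proj (edge_point x (f b) (f a) (m + s a - s b) t) =
    torus_proj (edge_point x' b a m t).
  apply/torus_proj_eqP; exists (- s b).
  rewrite /edge_point !sP of_latticeB of_latticeD of_latticeN.
  move: (lat (s a)) (lat (s b)) (lat m) => u v w.
  by apply/rowP => l; rewrite !mxE; ring.
split=> [m|_ [m Em <-]].
  rewrite -{1}[m](addrNK (s a - s b)) addrA.
  move: (m - (s a - s b)) (addrNK (s a - s b) m) => p <- /(exponents_edgeP xgen Tint)[].
  rewrite !degf => deg_ba edgeT; exists p; last by rewrite addrA.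
  apply/(exponents_edgeP x'gen T'int); split=> // t t01.
  by rewrite TT' -pointE; apply: edgeT.
have [deg_ba edgeT] := (exponents_edgeP x'gen T'int _ _ _).1 Em.
apply/(exponents_edgeP xgen Tint); rewrite !degf; split=> // t t01.
by rewrite pointE -TT'; apply: edgeT.
Qed.

End Recovery.

Theorem theorem3p7 (R : realType) (n : nat) :
  (forall F : based_seq R n, generically (fun x : seq_index F -> 'rV[R]_n =>
     interior (complex_image x) = set0 ->
     forall (k : nat) (i : 'I_k.+1 -> seq_index F) (mbar : 'I_k -> 'rV[int]_n),
       let sigma := simplex (fun j => x (i j)
             + of_lattice R (oapp mbar 0 (unlift ord0 j))) in
       complex_of x k sigma <->
         (forall l : 'I_k,
            seq_deg (i (prev_index l)) < seq_deg (i (next_index l))) /\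
         range sigma `<=` complex_image x))
  /\
  (exists recover : forall T T0 : set (torus R n),
       (T0 -> int) -> discrete_info n,
   forall F : based_seq R n, generically (fun x : seq_index F -> 'rV[R]_n =>
     interior (complex_image x) = set0 ->
     forall delta : complex_image0 x -> int, is_vertex_deg delta ->
       info_equiv (recover (complex_image x) (complex_image0 x) delta)
         (info_of F))).
Proof.
split=> [F|].
  apply: generically_sub (@generically_affinely_generic R n _) => x xgen Tint k i mbar.
  exact: simplex_complexP.
(* One recovery function must serve all sequences. It returns the information of some generic
   configuration with the given data; by [info_equiv_of_image] the choice does not matter up to
   equivalence. *)
pose realizes (T T0 : set (torus R n)) (delta : T0 -> int) D :=
  exists (F : based_seq R n) (x : seq_index F -> 'rV[R]_n),
    [/\ affinely_generic x, interior (complex_image x) = set0,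
        T = complex_image x, T0 = complex_image0 x
      & (forall (p : T0) i, val p = torus_proj (x i) -> delta p = seq_deg i) /\
        D = info_of F].
have realize (T T0 : set (torus R n)) (delta : T0 -> int) :
    exists D, (exists D', realizes T T0 delta D') -> realizes T T0 delta D.
  have [[D DP]|nD] := pselect (exists D', realizes T T0 delta D'); first by exists D.
  (* Data that no configuration realizes are sent to the empty information. *)
  by exists (DiscreteInfo (fun=> 0 : int) (fun _ _ : void => set0)).
exists (fun T T0 delta => sval (cid (realize T T0 delta))) => F.
apply: generically_sub (@generically_affinely_generic R n _) => x xgen Tint delta deltaP.
case: cid => D /= [].
  by exists (info_of F), F, x.
move=> F' [x' [x'gen Tint' TT' T0T0' [delta'P ->]]].
apply: (info_equiv_of_image xgen x'gen) => // i i' xx'.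
(* Both degrees are the value of [delta] at the common point. *)
have pT0 : torus_proj (x i) \in complex_image0 x.
  by rewrite inE; apply/complex_image0P; exists i.
rewrite -(deltaP (exist (fun q => q \in complex_image0 x) _ pT0) i) //.
exact: delta'P.
Qed.
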